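(* Let $q=2^m$ with $m\ge2$, let $V$ be a proper subgroup of $(\mathbb{F}_{2^m},+)$ of order $s$, and let $L=\{\overline{b_1},\dots,\overline{b_{2^{m-1}/s}}\}$ be a proper subgroup of the quotient group $\mathbb{F}_{2^m}/V$ of order $\frac{2^{m-1}}{s}$, where $\overline{b}=b+V$. Let $1\le k\le\frac{n-2}{2}$, let $\alpha_1,\dots,\alpha_n$ be distinct elements of $\bigcup_{j=1}^{2^{m-1}/s}(b_j+V)$, and let $\eta\in\mathbb{F}_{2^m}^*$ satisfy $\eta^{-1}\in\mathbb{F}_{2^m}\setminus\bigcup_{j=1}^{2^{m-1}/s}(b_j+V)$. Let $\beta\in\mathbb{F}_q\setminus\{0,1,-1\}$. For $i=1,\dots,n$ put $u_i=\prod_{1\le j\le n,\,j\ne i}(\alpha_i-\alpha_j)^{-1}$ and let $v_i\in\mathbb{F}_q$ be such that $u_i=v_i^2$. Put $\bm\alpha=(\alpha_1,\dots,\alpha_n)$ and $\bm v'=(v_1,\dots,v_k,\beta v_{k+1},\dots,\beta v_n)$. Then the generalized twisted Reed-Solomon code $GTRS_{k,n}[\bm\alpha,1,k-1,\eta,\bm v']$ is an LCD MDS code.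
   Context: For $\eta\in\mathbb{F}_q^*$, distinct $\alpha_1,\dots,\alpha_n\in\mathbb{F}_q$ and $\bm w=(w_1,\dots,w_n)\in(\mathbb{F}_q^* )^n$, the generalized twisted Reed-Solomon code with twist parameters $(t,h)=(1,k-1)$ is $$GTRS_{k,n}[\bm\alpha,1,k-1,\eta,\bm w]=\Big\{(w_1f(\alpha_1),\dots,w_nf(\alpha_n)) : f=\sum_{i=0}^{k-1}f_ix^i+\eta f_{k-1}x^{k},\ f_0,\dots,f_{k-1}\in\mathbb{F}_q\Big\}\subseteq\mathbb{F}_q^n.$$ A linear code of length $n$, dimension $k$ and minimum Hamming distance $d$ is MDS if $d=n-k+1$; here ''MDS'' means an MDS code of length $n$ and dimension $k$. A linear code $C\subseteq\mathbb{F}_q^n$ is LCD (linear complementary dual) if $C\cap C^\perp=\{0\}$, where $C^\perp$ is the dual with respect to the Euclidean inner product. *)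

(* Defs.v *)
From HB Require Import structures.
From mathcomp Require Import all_boot all_order all_algebra all_fingroup.
From mathcomp Require Import qpoly.

Set Implicit Arguments.
Unset Strict Implicit.
Unset Printing Implicit Defensive.

Import GRing.Theory.
Local Open Scope ring_scope.

(* A linear code of length n over F is a subspace C : {vspace 'rV[F]_n}. *)

Section Codes.
Variables (F : finFieldType) (n : nat).
Implicit Types (x y : 'rV[F]_n) (C : {vspace 'rV[F]_n}).

Definition hamming_dist x y : nat := #|[set i | x 0 i != y 0 i]|.

Definition is_min_dist C (d : nat) : Prop :=
  (exists x y, [/\ x \in C, y \in C, x != y & hamming_dist x y = d]) /\
  (forall x y, x \in C -> y \in C -> x != y -> (d <= hamming_dist x y)%N).

(* The truncated subtraction is harmless: \dim C = k forces k <= n. *)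
Definition is_MDS (k : nat) C : Prop :=
  \dim C = k /\ is_min_dist C (n - k + 1)%N.

Definition inner x y : F := \sum_(i < n) x 0 i * y 0 i.

Definition dual C : {set 'rV[F]_n} :=
  [set x | [forall y, (y \in C) ==> (inner x y == 0)]].

Definition is_LCD C : Prop := [set x in C] :&: dual C = [set 0].

End Codes.

Section GTRS.
Variables (F : finFieldType) (k n : nat).
Variables (alpha : 'I_n -> F) (eta : F) (w : 'I_n -> F).

(* p is the untwisted part f_0 + ... + f_{k-1} x^{k-1} of the polynomial. *)
Definition gtrs_poly (p : {poly_k F}) : {poly F} :=
  (p : {poly F}) + (eta * (p : {poly F})`_k.-1) *: 'X^k.

Definition gtrs_word (p : {poly_k F}) : 'rV[F]_n :=
  \row_(i < n) (w i * (gtrs_poly p).[alpha i]).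

Fact gtrs_word_linear : linear gtrs_word.
Proof.
move=> a p q; apply/rowP=> i; rewrite !mxE mulrCA -mulrDr; congr (_ * _).
rewrite -hornerZ -hornerD; congr _.[_]; rewrite /gtrs_poly /=.
by rewrite coefD coefZ mulrDr scalerDl scalerDr scalerA mulrCA addrACA.
Qed.

HB.instance Definition _ :=
  GRing.isLinear.Build F {poly_k F} 'rV[F]_n *:%R gtrs_word gtrs_word_linear.

(* GTRS_{k,n}[alpha, 1, k-1, eta, w]; meaningful for 0 < k only, since it uses
   the coefficient of index k.-1. *)
Definition GTRS : {vspace 'rV[F]_n} := limg (linfun gtrs_word).

Lemma mem_GTRS (c : 'rV[F]_n) : (0 < k)%N ->
  c \in GTRS <->
  exists f : nat -> F,
    c = \row_(i < n) (w i *
          (\sum_(j < k) f j *: 'X^j + (eta * f k.-1) *: 'X^k).[alpha i]).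
Proof.
move=> k_gt0; split=> [/memv_imgP[p _ ->]|[f ->]].
  exists (fun j => (p : {poly F})`_j); rewrite lfunE; apply/rowP=> i.
  rewrite !mxE /gtrs_poly -poly_def; congr (_ * (_ + _).[_]).
  apply/polyP=> j; rewrite coef_poly; case: ltnP => // le_kj.
  by rewrite nth_default // (leq_trans _ le_kj) // size_npoly.
apply/memv_imgP; exists (npolyp k (\poly_(j < k) f j)); first exact: memvf.
rewrite lfunE; apply/rowP=> i; rewrite !mxE /gtrs_poly.
rewrite npolypK ?qualifE /= ?size_poly // coef_poly prednK // leqnn.
by rewrite poly_def.
Qed.

End GTRS.

(* Main.v *)
(* A twisted polynomial f (f_k = eta f_{k-1}, degree at most k) with k distinct
   roots r_i is a multiple of prod (X - r_i), so by Vieta either f = 0 or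
   eta^-1 = - sum r_i.  The evaluation points lie in U, the preimage of L, which
   is an additive subgroup missing eta^-1; hence nonzero twisted polynomials
   vanish at fewer than k of the points, which gives the MDS property.  For the
   LCD property, sum u_i h(alpha_i) = 0 whenever deg h <= n - 2, and this applies
   to products of two twisted polynomials. *)
Require Import Defs.
From mathcomp Require Import all_boot all_order all_algebra all_fingroup.
From mathcomp Require Import qpoly ring.

Set Implicit Arguments.
Unset Strict Implicit.
Unset Printing Implicit Defensive.

Import GRing.Theory.
Local Open Scope ring_scope.

(** * Twisted polynomials and Vieta's formula *)

Section TwistedPolynomials.
Variables (F : fieldType) (k : nat) (eta : F).

(** A condition on coefficients instead of a parametrization by messages, so that arguments on roots
    apply directly. *)
Definition twisted (f : {poly F}) : Prop :=
  (size f <= k.+1)%N /\ f`_k = eta * f`_k.-1.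

(** Removing the multiple [f]_k *: P[of the monic polynomial]P[with roots]rs[leaves size at most k
    and k roots, hence zero. The coefficient of index k-1, combined with the twist, then
    gives]f[_k * (1 + eta * sum) = 0]. *)
Lemma twisted_eq0 (f : {poly F}) (rs : seq F) :
  (0 < k)%N -> twisted f -> size rs = k -> uniq rs -> all (root f) rs ->
  1 + eta * (\sum_(r <- rs) r) != 0 -> f = 0.
Proof.
move=> k0 [sf fk] srs urs frs hsum.
pose P := \prod_(r <- rs) ('X - r%:P).
have sP : size P = k.+1 by rewrite size_prod_XsubC srs.
have Pk : P`_k = 1.
  by have /monicP := monic_prod_XsubC rs xpredT id; rewrite lead_coefE sP.
have Pk1 : P`_k.-1 = - \sum_(r <- rs) r.
  by rewrite -srs coefPn_prod_XsubC // srs -lt0n.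
have : f - f`_k *: P = 0.
  apply: (roots_geq_poly_eq0 (rs := rs)) => //.
    apply/allP=> r rin; rewrite rootE hornerD hornerN hornerZ.
    have /rootP-> := allP frs _ rin.
    have /rootP-> : root P r by rewrite root_prod_XsubC.
    by rewrite mulr0 subr0.
  rewrite srs; apply/leq_sizeP=> j; rewrite leq_eqVlt coefB coefZ.
  case/predU1P=> [<-|lt_kj]; first by rewrite Pk mulr1 subrr.
  rewrite (nth_default _ (leq_trans sf lt_kj)).
  by rewrite [P`_j]nth_default ?sP ?mulr0 ?subrr.
move=> /subr0_eq fE.
have fk1 : f`_k.-1 = - (f`_k * \sum_(r <- rs) r).
  by rewrite {1}fE coefZ Pk1 mulrN.
suff /eqP : f`_k * (1 + eta * \sum_(r <- rs) r) = 0.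
  rewrite mulf_eq0 (negPf hsum) orbF => /eqP fk0.
  by rewrite fE fk0 scale0r.
by rewrite mulrDr mulr1 {1}fk fk1; ring.
Qed.

(** Source of words with prescribed zeros, both for attaining the minimum distance and for testing
    orthogonality. The extra root may repeat an entry of [rs]. *)
Lemma twisted_with_roots (rs : seq F) :
  eta != 0 -> size rs = k.-1 -> (0 < k)%N ->
  exists2 f, twisted f & f != 0 /\ all (root f) rs.
Proof.
move=> eta0 srs k0.
(* The extra root is forced by Vieta's formula. *)
pose ss := (- eta^-1 - \sum_(r <- rs) r) :: rs.
have sss : size ss = k by rewrite /= srs prednK.
have mon := monic_prod_XsubC ss xpredT id.
exists (\prod_(r <- ss) ('X - r%:P)); last first.
  split; first exact: monic_neq0.
  by apply/allP=> r rin; rewrite root_prod_XsubC in_cons rin orbT.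
have sP : size (\prod_(r <- ss) ('X - r%:P)) = k.+1.
  by rewrite size_prod_XsubC sss.
split; first by rewrite sP.
have /monicP := mon; rewrite lead_coefE sP /= => ->.
(* By the choice of the extra root, the roots sum to [- eta^-1]. *)
rewrite -sss coefPn_prod_XsubC // big_cons.
by rewrite addrNK opprK mulfV.
Qed.

End TwistedPolynomials.

(** * Lagrange interpolation weights *)

Lemma sum_lagrange_weights (F : fieldType) (n : nat) (alpha : 'I_n -> F)
    (h : {poly F}) :
  injective alpha -> (size h < n)%N ->
  \sum_i (\prod_(j < n | j != i) (alpha i - alpha j)^-1) * h.[alpha i] = 0.
Proof.
move=> inj_alpha sh.
pose P i := \prod_(j < n | j != i) ('X - (alpha j)%:P).
have sP i : size (P i) = n.
  have -> : P i = \prod_(j <- enum (predC1 i)) ('X - (alpha j)%:P).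
    by rewrite big_enum.
  by rewrite size_prod_XsubC -cardE cardC1 card_ord (ltn_predK (ltn_ord i)).
have lP i : (P i)`_n.-1 = 1.
  have /monicP : P i \is monic by apply: monic_prod => *; apply: monicXsubC.
  by rewrite lead_coefE sP.
pose u i := \prod_(j < n | j != i) (alpha i - alpha j)^-1.
pose Q := \sum_i (u i * h.[alpha i]) *: P i.
(* [Q] is the Lagrange interpolant of [h]: both have size at most n and agree at n distinct
   points. *)
have hQ : h = Q.
  apply/eqP; rewrite -subr_eq0; apply/eqP.
  apply: (roots_geq_poly_eq0 (rs := [seq alpha i | i : 'I_n])).
  - apply/allP=> _ /mapP[i _ ->]; rewrite rootE hornerD hornerN horner_sum.
    rewrite (bigD1 i) //= big1 ?addr0 => [|j ji]; last first.
      rewrite hornerZ horner_prod (bigD1 i) 1?eq_sym //= hornerXsubC subrr.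
      by rewrite mul0r mulr0.
    rewrite hornerZ horner_prod mulrAC -big_split /= big1 => [|j ji].
      by rewrite mul1r subrr.
    rewrite hornerXsubC mulVf // subr_eq0.
    by apply: contra ji => /eqP/inj_alpha->.
  - by rewrite map_inj_uniq ?enum_uniq.
  - rewrite size_map size_enum_ord.
    rewrite (leq_trans (size_polyD _ _)) // geq_max (ltnW sh) size_polyN /=.
    apply: (leq_trans (size_sum _ _ _)); apply/bigmax_leqP => i _.
    by rewrite (leq_trans (size_scale_leq _ _)) ?sP.
(* Each [P i] is monic of degree n-1, so the sum is the coefficient of index n-1 of [Q]. It vanishes
   because [h] has degree at most n-2. *)
transitivity Q`_n.-1; last by rewrite -hQ nth_default // -ltnS (ltn_predK sh).
rewrite coef_sum; apply: eq_bigr => i _.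
by rewrite coefZ lP mulr1.
Qed.

(** * Dimension and minimum distance of the code *)

Section GTRSCode.
Variables (F : finFieldType) (k n : nat).
Variables (alpha : 'I_n -> F) (eta : F) (w : 'I_n -> F).
Hypothesis k_gt0 : (0 < k)%N.
Hypothesis k_le_n : (k <= n)%N.
Hypothesis inj_alpha : injective alpha.
Hypothesis eta0 : eta != 0.
Hypothesis w0 : forall i, w i != 0.
(** The form in which the avoidance of [eta^-1] enters the coding argument: it is never minus the
    sum of k distinct evaluation points. *)
Hypothesis sum_neq : forall A : {set 'I_n},
  #|A| = k -> 1 + eta * (\sum_(i in A) alpha i) != 0.

Lemma twisted_gtrs_poly (p : {poly_k F}) : twisted k eta (gtrs_poly eta p).
Proof.
have sp : (size (p : {poly F}) <= k)%N by apply: size_npoly.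
have lt : (k.-1 < k)%N by rewrite prednK.
split; last first.
  rewrite /gtrs_poly !coefD !coefZ !coefXn eqxx (ltn_eqF lt) mulr1 mulr0 addr0.
  by rewrite nth_default ?add0r.
rewrite (leq_trans (size_polyD _ _)) // geq_max (leq_trans sp) //=.
by rewrite (leq_trans (size_scale_leq _ _)) ?size_polyXn.
Qed.

Lemma mem_GTRS_twisted (c : 'rV[F]_n) :
  c \in GTRS k alpha eta w <->
  exists2 f, twisted k eta f & c = \row_i (w i * f.[alpha i]).
Proof.
split=> [/memv_imgP[p _ ->]|[f [sf fk] ->]].
  by exists (gtrs_poly eta p); rewrite ?lfunE //; apply: twisted_gtrs_poly.
(* The message consists of the coefficients of [f] below k; the twist recovers the one of index
   k. *)
apply/mem_GTRS=> //; exists (fun j => f`_j); apply/rowP=> i; rewrite !mxE.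
congr (_ * _.[_]); rewrite -fk -poly_def -[LHS]coefK; apply/polyP=> j.
rewrite coefD coefZ coefXn !coef_poly.
case: (ltngtP j k) => [jk|jk|->]; rewrite ?mulr0 ?mulr1 ?addr0 ?add0r //.
- by case: ltnP => // /(nth_default 0).
- by rewrite ltnNge (leq_trans sf).
- by case: ltnP => // /(nth_default 0).
Qed.

Lemma twisted_zeros (f : {poly F}) :
  twisted k eta f -> f != 0 -> (#|[set i | root f (alpha i)]| < k)%N.
Proof.
move=> tf; apply: contra_neqT; rewrite -leqNgt => kZ.
have [A [uA sA AZ]] := card_geqP kZ.
apply: (twisted_eq0 (rs := map alpha A) k_gt0 tf); rewrite ?size_map //.
- by rewrite map_inj_uniq.
- by apply/allP=> _ /mapP[i /AZ + ->]; rewrite inE.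
rewrite big_map big_uniq //=.
have := sum_neq (A := [set i in A]); rewrite cardsE (card_uniqP uA) => /(_ sA).
by rewrite (eq_bigl _ _ (in_set _)).
Qed.

(** The k-1 prescribed zeros already reach the bound of [twisted_zeros], so the forced extra root
    adds no further position. *)
Lemma twisted_interp (A : {set 'I_n}) :
  #|A| = k.-1 ->
  exists f, [/\ twisted k eta f, f != 0 &
                forall i, root f (alpha i) = (i \in A)].
Proof.
move=> cA.
have srs : size [seq alpha i | i in A] = k.-1 by rewrite size_map -cardE.
have [f tf [f0 frs]] := twisted_with_roots eta0 srs k_gt0.
exists f; split=> // i.
have sAZ : A \subset [set i | root f (alpha i)].
  apply/subsetP=> j jA; rewrite inE; apply: (allP frs).
  by apply: map_f; rewrite mem_enum.
suff -> : A = [set i | root f (alpha i)] by rewrite inE.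
apply/eqP; rewrite eqEcard sAZ cA -ltnS prednK //.
exact: twisted_zeros.
Qed.

Lemma twisted_word_support (f : {poly F}) :
  [set i | (\row_i (w i * f.[alpha i])) 0 i != 0] =
  ~: [set i | root f (alpha i)].
Proof. by apply/setP=> i; rewrite !inE mxE mulf_eq0 (negPf (w0 i)). Qed.

Lemma twisted_word_weight (f : {poly F}) :
  twisted k eta f -> f != 0 ->
  (n - k + 1 <= #|[set i | ((\row_i (w i * f.[alpha i])) 0 i != 0)%R]|)%N.
Proof.
move=> tf f0; rewrite twisted_word_support cardsCs setCK card_ord.
have zk := twisted_zeros tf f0.
by rewrite addn1 ltn_sub2l ?(leq_trans zk).
Qed.

(** Encoding is injective: a nonzero twisted polynomial yields a word of weight at least n-k+1,
    which is positive. *)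
Lemma dim_GTRS : \dim (GTRS k alpha eta w) = k.
Proof.
rewrite /GTRS limg_dim_eq ?dimvf //; apply/eqP; rewrite -subv0.
apply/subvP=> p; rewrite memv_cap memvf memv_ker lfunE memv0 /= => /eqP p0.
have gp0 : gtrs_poly eta p = 0.
  apply/eqP/negPn/negP=> /(twisted_word_weight (twisted_gtrs_poly p)).
  rewrite -[\row_i _]/(gtrs_word alpha eta w p) p0.
  by rewrite (eq_card0 (A := _)) ?addn1 // => i; rewrite !inE mxE eqxx.
(* The twist term only affects index k, so index k-1 still shows the coefficient of [p]; once it is
   zero, the twist term disappears. *)
have pk : (p : {poly F})`_k.-1 = 0.
  have /polyP/(_ k.-1) := gp0; rewrite /gtrs_poly coefD coefZ coefXn coef0.
  by rewrite ltn_eqF ?prednK // mulr0 addr0.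
by apply/eqP/val_inj; rewrite /= -gp0 /gtrs_poly pk mulr0 scale0r addr0.
Qed.

Lemma GTRS_MDS : is_MDS k (GTRS k alpha eta w).
Proof.
split; first exact: dim_GTRS.
have distE x y : hamming_dist x y = #|[set i | (x - y) 0 i != 0]|.
  by apply: eq_card => i; rewrite !inE !mxE subr_eq0.
have minw (c : 'rV[F]_n) : c \in GTRS k alpha eta w -> c != 0 ->
    (n - k + 1 <= #|[set i | c 0%R i != 0%R]|)%N.
  move=> /mem_GTRS_twisted[f tf ->] c0; apply: twisted_word_weight => //.
  apply: contraNneq c0 => ->.
  by apply/eqP/rowP=> i; rewrite !mxE horner0 mulr0.
split; last first.
  by move=> x y xC yC; rewrite distE -subr_eq0; apply: minw; rewrite rpredB.
(* The bound is attained by a twisted polynomial vanishing at exactly k-1 positions, which may be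
   chosen arbitrarily. *)
have [A cA] : exists A : {set 'I_n}, #|A| = k.-1.
  have : (k.-1 <= #|'I_n|)%N by rewrite card_ord (leq_trans (leq_pred _)).
  case/card_geqP=> s [us ss _]; exists [set i in s].
  by rewrite cardsE (card_uniqP us).
have [f [tf f0 fA]] := twisted_interp cA.
pose c := \row_i (w i * f.[alpha i]).
have wc : #|[set i | c 0 i != 0]| = (n - k + 1)%N.
  rewrite twisted_word_support cardsCs setCK card_ord.
  have -> : [set i | root f (alpha i)] = A by apply/setP=> i; rewrite inE fA.
  by rewrite cA addn1 -subSn // -subSS prednK.
exists c, 0; split; rewrite ?mem0v //; last by rewrite distE subr0.
  by apply/mem_GTRS_twisted; exists f.
apply: contra_eq_neq wc => ->.
by rewrite (eq_card0 (A := _)) ?addn1 // => i; rewrite !inE mxE eqxx.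
Qed.

End GTRSCode.

(** * Trivial intersection with the dual code *)

(* Since [size (f * g) <= n - 1], the weighted products sum to zero over all
   positions, so orthogonality for the rescaled code becomes orthogonality on
   the first k positions, which form an information set. *)
Lemma GTRS_LCD (F : finFieldType) (k n : nat) (alpha : 'I_n -> F)
    (eta beta : F) (v : 'I_n -> F) :
  (0 < k)%N -> (k.*2.+1 < n)%N -> injective alpha -> eta != 0 ->
  (forall A : {set 'I_n},
     #|A| = k -> 1 + eta * (\sum_(i in A) alpha i) != 0) ->
  (forall i, v i ^+ 2 = \prod_(j < n | j != i) (alpha i - alpha j)^-1) ->
  beta ^+ 2 != 1 ->
  is_LCD (GTRS k alpha eta (fun i => if (i < k)%N then v i else beta * v i)).
Proof.
move=> k0 kn inj_alpha eta0 sum_neq hv hbeta.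
apply/setP=> c; rewrite !inE; apply/andP/eqP => [[]|->]; last first.
  split; first exact: mem0v.
  apply/forallP=> y; apply/implyP=> _.
  by apply/eqP/big1 => i _; rewrite mxE mul0r.
case/(mem_GTRS_twisted _ _ _ k0)=> f tf -> /forallP dualf.
have v0 i : v i != 0.
  rewrite -sqrf_eq0 hv; apply/prodf_neq0 => j ji.
  by rewrite invr_eq0 subr_eq0; apply: contra ji => /eqP/inj_alpha->.
suff -> : f = 0 by apply/rowP=> i; rewrite !mxE horner0 mulr0.
have k_le_n : (k <= n)%N.
  by rewrite (leq_trans _ (ltnW kn)) // -addnn -addnS leq_addr.
(* Let [S] and [T] be the weighted sums over the first k and the remaining positions. Interpolation
   gives [S + T = 0] and duality gives [S + beta ^+ 2 * T = 0], whence [S = 0]. *)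
have orth g : twisted k eta g ->
    \sum_(i < n | (i < k)%N) v i ^+ 2 * (f * g).[alpha i] = 0.
  move=> tg.
  pose d : 'rV[F]_n :=
    \row_i ((if (i < k)%N then v i else beta * v i) * g.[alpha i]).
  have dC : d \in GTRS k alpha eta
      (fun i => if (i < k)%N then v i else beta * v i).
    by apply/(mem_GTRS_twisted _ _ _ k0); exists g.
  have := dualf d; rewrite dC => /eqP inner0.
  (* Two factors of size at most k+1 have a product of size at most 2k+1. *)
  have sfg : (size (f * g)%R < n)%N.
    apply: leq_ltn_trans (size_polyMleq _ _) (leq_ltn_trans _ kn).
    case: tf tg => sf _ [sg _]; rewrite -subn1 leq_subLR.
    by rewrite (leq_trans (leq_add sf sg)) // addSn addnS addnn.
  have := sum_lagrange_weights inj_alpha sfg.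
  under eq_bigr do rewrite -hv.
  set S := (X in _ -> X = 0).
  rewrite (bigID (fun i : 'I_n => (i < k)%N)) /= -/S.
  set T := (X in _ + X) => ST.
  have : S + beta ^+ 2 * T = 0.
    rewrite -[RHS]inner0 /S /T /inner.
    rewrite [RHS](bigID (fun i : 'I_n => (i < k)%N)) /=.
    rewrite [X in _ + X]mulr_sumr; congr (_ + _); apply: eq_bigr => i.
      by move=> ik; rewrite !mxE ik hornerM; ring.
    by move=> /negPf ik; rewrite !mxE ik hornerM; ring.
  have -> : T = - S by apply/eqP; rewrite -addr_eq0 addrC ST.
  move=> /eqP; rewrite mulrN -[X in X - _]mul1r -mulrBl mulf_eq0 subr_eq0.
  by rewrite eq_sym (negPf hbeta) => /eqP.
pose K := [set i : 'I_n | (i < k)%N].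
have cK : #|K| = k.
  rewrite cardsE -sum1_card -[RHS]card_ord -[RHS]sum1_card.
  by rewrite [RHS](big_ord_widen n (fun=> 1%N)).
(* A nonzero [f] has fewer than k zeros among the points, so it is enough to show that it vanishes
   at all of the first k. *)
apply/eqP/negPn/negP=> f0.
have := twisted_zeros k0 inj_alpha sum_neq tf f0.
rewrite ltnNge -{1}cK subset_leq_card //; apply/subsetP=> i iK; rewrite inE.
(* The test polynomial [g] vanishes exactly at the other positions of [K]; only the term at [i]
   survives in [orth], which forces [f] to vanish there. *)
have cKi : #|K :\ i| = k.-1 by rewrite -cK (cardsD1 i K) iK.
have [g [tg g0 gK]] := twisted_interp k0 inj_alpha eta0 sum_neq cKi.
have := orth g tg; rewrite (bigD1 i) /=; last by move: iK; rewrite inE.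
rewrite big1 ?addr0 => [/eqP|j /andP[jk ji]]; last first.
  have /rootP gj : root g (alpha j) by rewrite gK !inE ji.
  by rewrite hornerM gj !mulr0.
rewrite mulf_eq0 (negPf (expf_neq0 _ (v0 i))) /= hornerM mulf_eq0.
by rewrite -!rootE gK !inE eqxx orbF.
Qed.

(** * The additive subgroup containing the evaluation points *)

(** As a preimage under the quotient morphism, the union of cosets is a subgroup, hence closed under
    sums and opposites. *)
Lemma cosets_of_subgroup (F : finFieldType) (V : {group F})
    (L : {group coset_of V}) (t : nat) (b : 'I_t -> F) :
  L = [set coset V (b j) | j : 'I_t] :> {set coset_of V} ->
  \bigcup_j [set b j + x | x in V] = (coset V @*^-1 L)%g.
Proof.
move=> hb.
(* The morphism [coset V] has domain ['N(V)], which is everything since addition is commutative. *)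
have NV (x : F) : x \in 'N(V)%g.
  exact: (subsetP (sub_abelian_norm (FinRing.zmod_abelian _) (subsetT V))).
rewrite hb; apply/setP=> x; apply/bigcupP/morphpreP=> [[j _]|[_]].
  move=> /imsetP[y yV ->]; split; first exact: NV.
  apply/imsetP; exists j => //.
  apply/rcoset_kercosetP; rewrite ?NV //.
  by rewrite addrC -FinRing.zmodMgE; apply/rcosetP; exists y.
move=> /imsetP[j _ cx]; exists j => //.
have /rcosetP[y yV xE] : x \in (V :* b j)%g by apply/rcoset_kercosetP.
by apply/imsetP; exists y => //; rewrite xE FinRing.zmodMgE addrC.
Qed.

Lemma sum_group (F : finFieldType) (U : {group F}) (I : finType) (P : pred I)
    (a : I -> F) :
  (forall i, a i \in U) -> \sum_(i | P i) a i \in U.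
Proof.
move=> aU; elim/big_rec: _ => [|i x _ xU].
  by rewrite -FinRing.zmod1gE group1.
by rewrite -FinRing.zmodMgE groupM.
Qed.

(* The group structure carried by F is the additive one. *)
Theorem corollary4p1 (F : finFieldType) (m : nat)
    (hm : (2 <= m)%N) (hF : #|F| = (2 ^ m)%N)
    (V : {group F}) (s : nat)
    (hV : V \proper [set: F]) (hs : #|V| = s)
    (L : {group coset_of V})
    (hL : L \proper ([set: F] / V)%g) (hLs : #|L| = (2 ^ m.-1 %/ s)%N)
    (b : 'I_(2 ^ m.-1 %/ s) -> F)
    (hb : L = [set coset V (b j) | j : 'I_(2 ^ m.-1 %/ s)] :> {set coset_of V})
    (U : {set F}) (hU : U = \bigcup_j [set b j + x | x in V])
    (n k : nat) (hk : (1 <= k <= (n - 2) %/ 2)%N)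
    (alpha : 'I_n -> F) (halpha : injective alpha)
    (halphaU : forall i, alpha i \in U)
    (eta : F) (heta : eta != 0) (hetaU : eta^-1 \notin U)
    (beta : F) (hbeta : beta \notin [:: 0; 1; -1])
    (u v : 'I_n -> F)
    (hu : forall i, u i = \prod_(j < n | j != i) (alpha i - alpha j)^-1)
    (hv : forall i, u i = v i ^+ 2) :
  let v' := fun i : 'I_n => if (i < k)%N then v i else beta * v i in
  is_LCD (GTRS k alpha eta v') /\ is_MDS k (GTRS k alpha eta v').
Proof.
move=> v'.
(* Positivity of k rules out truncation in [n - 2], so the bound on k amounts to 2k+2 <= n. *)
have [k0 kn] : (0 < k)%N /\ (k.*2.+1 < n)%N.
  case/andP: hk => k0; rewrite leq_divRL // muln2 => k2; split=> //.
  have n2 : (2 < n)%N.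
    by rewrite -subn_gt0 (leq_trans _ k2) // double_gt0.
  by rewrite -(subnK (ltnW n2)) addn2 !ltnS.
have k_le_n : (k <= n)%N.
  by rewrite (leq_trans _ (ltnW kn)) // -addnn -addnS leq_addr.
have v0 i : v i != 0.
  rewrite -sqrf_eq0 -hv hu; apply/prodf_neq0 => j ji.
  by rewrite invr_eq0 subr_eq0; apply: contra ji => /eqP/halpha->.
move: hbeta; rewrite !inE !negb_or => /and3P[beta0 beta1 betaN1].
(* Otherwise [eta^-1] would be the opposite of a sum of elements of the subgroup [U], hence an
   element of [U]. *)
have sum_neq (A : {set 'I_n}) :
    #|A| = k -> 1 + eta * (\sum_(i in A) alpha i) != 0.
  move=> _; apply: contra hetaU => /eqP sum0.
  have -> : eta^-1 = - \sum_(i in A) alpha i.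
    apply/eqP; rewrite -addr_eq0 -(inj_eq (mulfI heta)) mulr0 mulrDr mulfV //.
    exact/eqP.
  move: halphaU; rewrite hU (cosets_of_subgroup hb) => halphaU.
  by rewrite -FinRing.zmodVgE groupV sum_group.
split; last first.
  apply: GTRS_MDS => // i; rewrite /v'.
  by case: ifP => // _; rewrite mulf_neq0.
apply: GTRS_LCD => // [i|]; first by rewrite -hv hu.
by rewrite sqrf_eq1 negb_or beta1.
Qed.
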